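(* There is an absolute constant $C$ such that for every pair of integers $a \ge 2$, $b \ge 1$, every digraph $D$ with $\delta^+(D) \ge C a b^7$ and directed girth $\vec{g}(D) \ge 4b^2$ contains a subdivision of $C_{a,b}$.
   Context: Digraphs are finite, loopless, have no parallel arcs, but may contain digons. The directed girth $\vec{g}(D)$ is the minimum length of a directed cycle in $D$. For integers $a,b\ge1$, $C_{a,b}$ is the oriented cycle consisting of $2a$ vertices $s_1,\dots,s_a,t_1,\dots,t_a$ and $2a$ internally vertex-disjoint directed paths of length $b$: one from $s_i$ to $t_i$ and one from $s_i$ to $t_{i+1}$ for each $1\le i\le a$ (indices modulo $a$). A subdivision of a digraph $F$ is obtained by replacing each arc $(x,y)$ by a directed $x$-$y$-path, with paths for different arcs internally vertex-disjoint. *)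

(* Defs.v *)
From mathcomp Require Import all_boot.
Set Implicit Arguments. Unset Strict Implicit. Unset Printing Implicit Defensive.

(* Minimum out-degree at least k (for a nonempty vertex set, see Statement). *)
Definition min_outdeg_ge (V : finType) (E : rel V) (k : nat) : Prop :=
  forall v : V, k <= #|[set w | E v w]|.

(* Directed girth at least g: every directed cycle x_0 -> ... -> x_{m-1} -> x_0
   on distinct vertices has length m >= g (vacuous if D is acyclic). *)
Definition dgirth_ge (V : finType) (E : rel V) (g : nat) : Prop :=
  forall s : seq V, s != [::] -> uniq s -> cycle E s -> g <= size s.

Definition contains_subdivision (U : finType) (A : rel U)
    (V : finType) (E : rel V) : Prop :=
  exists phi : U -> V, injective phi /\
  exists P : U -> U -> seq V,
    (forall x y, A x y ->
       [/\ path E (phi x) (rcons (P x y) (phi y)),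
           uniq (P x y) &
           forall v, v \in P x y -> forall u, v != phi u]) /\
    (forall x y x' y', A x y -> A x' y' -> (x, y) != (x', y') ->
       forall v, v \in P x y -> v \notin P x' y').

(* The oriented cycle C_{a,b} (indices 0..a-1 instead of 1..a).
   Vertices: s_i = inl (inl i), t_i = inl (inr i), and the b-1 internal
   vertices inr (i, d, j) of the path from s_i to t_i (d = false) or to
   t_{i+1 mod a} (d = true). *)
Definition Cab_vert (a b : nat) : finType :=
  ('I_a + 'I_a + ('I_a * bool * 'I_b.-1))%type.

Definition Cab_pos (a b : nat) (i : 'I_a) (d : bool) (k : nat) : Cab_vert a b :=
  if k == 0 then inl (inl i)
  else if b <= k then inl (inr (if d then ordS i else i))
  else match insub k.-1 : option 'I_b.-1 with
       | Some j => inr (i, d, j)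
       | None => inl (inl i)
       end.

Definition Cab_rel (a b : nat) : rel (Cab_vert a b) :=
  fun u v => [exists i : 'I_a, [exists d : bool, [exists k : 'I_b,
     (Cab_pos b i d k == u) && (Cab_pos b i d k.+1 == v)]]].

(* Main.v *)
(* Idea.  Choose T nonempty and minimal such that at most M vertices outside T receive
   an arc from T.  If Q is a set of at most M/2 vertices, then two walks leaving Q inside
   T can be made to meet outside Q: the sets they reach would otherwise be disjoint
   proper subsets of T, and their out-neighbours outside Q could not all fit among the M
   out-neighbours of T.  So it suffices to find in T, with O(ab) vertices, a path of 2a
   blocks of length b with alternating directions whose two ends are sinks.  This is done
   greedily in a family of paths of length b that is robust: no small set can block all
   members with a given first, or a given last, vertex.  If there were no such family, every
   path of length b from s to t would be blocked by a small set Zp s or Zm t.  A random walk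
   that always avoids its last b vertices and their sets Zp would then have its current
   vertex t preceded, among the last b steps, by a vertex of Zm t; hence the largest
   probability of being at one vertex would halve every b steps, which is absurd. *)
Require Import Defs.
From mathcomp Require Import all_boot.
From mathcomp Require Import zify.
Set Implicit Arguments. Unset Strict Implicit. Unset Printing Implicit Defensive.

(** * Counting walks whose next step may depend on the past *)

Section Walks.
Variables (V : finType) (x0 : V) (out : seq V -> seq V).

(* Walks are stored backwards, so the head is the current vertex and [out] may depend on
   the whole past. *)
Fixpoint walks n : seq (seq V) :=
  if n is m.+1 then flatten [seq [seq y :: h | y <- out h] | h <- walks m]
  else [:: [:: x0]].

Variables (good : pred (seq V)) (D : nat).
Hypothesis good0 : good [:: x0].
Hypothesis goodS : forall h, good h ->
  [/\ uniq (out h), size (out h) = D & forall y, y \in out h -> good (y :: h)].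

Lemma walks_good n h : h \in walks n -> good h && (size h == n.+1).
Proof.
elim: n h => [|n IHn] h /=; first by rewrite inE => /eqP ->; rewrite good0.
case/flatten_mapP => h' /IHn /andP[gh' /eqP sh'] /mapP[y yh' ->] /=.
by have [_ _ -> //] := goodS gh'; rewrite sh' eqxx.
Qed.

Lemma count_walksS (a : pred V) (P : pred (seq V)) k n :
  (forall h, good h -> count a (out h) <= k) ->
  count (fun h => a (head x0 h) && P (behead h)) (walks n.+1)
    <= k * count P (walks n).
Proof.
move=> ak; rewrite /= count_flatten -map_comp.
have: {in walks n, forall h, good h} by move=> h /walks_good /andP[].
elim: (walks n) => //= h s IHs gs; rewrite mulnDr leq_add //; last first.
  by apply: IHs => x xs; apply: gs; rewrite inE xs orbT.
rewrite count_map /=; case Ph: (P h); last first.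
  by rewrite (eq_count (a2 := pred0)) ?count_pred0 // => y /=; rewrite Ph andbF.
rewrite muln1 (eq_count (a2 := a)); first by rewrite ak ?gs ?mem_head.
by move=> y /=; rewrite Ph andbT.
Qed.

Lemma size_walks n : size (walks n) = D ^ n.
Proof.
elim: n => //= n IHn; rewrite size_flatten /shape -map_comp.
rewrite expnS -IHn.
have: {in walks n, forall h, good h} by move=> h /walks_good /andP[].
elim: (walks n) => [|h s IHs] /= gs; first by rewrite muln0.
rewrite size_map mulnS IHs; last by move=> x xs; apply: gs; rewrite inE xs orbT.
by have [_ -> _] := goodS (gs h (mem_head _ _)).
Qed.

Lemma count_walks_drop (P : pred (seq V)) k n :
  count (fun h => P (drop k h)) (walks (n + k)) <= D ^ k * count P (walks n).
Proof.
elim: k => [|k IHk]; first by rewrite addn0 mul1n; under eq_count do rewrite drop0.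
rewrite addnS expnS -mulnA (leq_trans _ (leq_mul (leqnn D) IHk)) //.
apply: leq_trans (@count_walksS predT (fun h => P (drop k h)) D (n + k) _).
  by apply: sub_count => h /=; rewrite -drop1 drop_drop addn1.
by move=> h /goodS[_ <- _]; rewrite count_size.
Qed.

Definition ends_at v (h : seq V) := head x0 h == v.

(** Of the [k.+1] steps from [z] to [t], the first [k] have [D] choices each, but the last is
    forced, as [out h] has no repetition. The factor [D] saved pays for the union bound below. *)
Lemma count_walks_between t z k n :
  count (fun h => ends_at t h && ends_at z (drop k.+1 h)) (walks (n + k.+1))
    <= D ^ k * count (ends_at z) (walks n).
Proof.
apply: leq_trans (count_walks_drop _ _ _); rewrite addnS -[leqRHS]mul1n.
apply: leq_trans (@count_walksS (pred1 t) (fun h => ends_at z (drop k h)) 1 _ _).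
  by apply: sub_count => h /=; rewrite -addn1 -drop_drop drop1.
by move=> h /goodS[uh _ _]; rewrite count_uniq_mem ?leq_b1.
Qed.

Variables (b q : nat) (Z : V -> {set V}).
Hypotheses (D_gt0 : 0 < D) (leZD : 2 * b * q <= D) (cardZ : forall t, #|Z t| <= q).

(** Only used for walks of more than [b] vertices, where the default [x0] is never read. *)
Definition blocked (h : seq V) := [exists k : 'I_b, head x0 (drop k.+1 h) \in Z (head x0 h)].

Lemma count_blocked n t : b <= n -> all blocked (walks n) ->
  count (ends_at t) (walks n)
    <= \sum_(k < b) \sum_(z in Z t) D ^ k * count (ends_at z) (walks (n - k.+1)).
Proof.
move=> le_bn /allP bl.
have: count (ends_at t) (walks n) <= \sum_(k < b) \sum_(z in Z t)
    count (fun h => ends_at t h && ends_at z (drop k.+1 h)) (walks n).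
  rewrite -sum1_count big_mkcond.
  under [leqRHS]eq_bigr => k _ do under eq_bigr => z _ do
    rewrite -sum1_count big_mkcond.
  under [leqRHS]eq_bigr => k _ do rewrite exchange_big.
  rewrite exchange_big /= big_seq [leqRHS]big_seq leq_sum // => h /bl /existsP[k Zk].
  case: ifP => // /eqP ht; rewrite (bigD1 k) //= (bigD1 (head x0 (drop k.+1 h))) -?ht //=.
  by rewrite /ends_at !eqxx /= -addnA leq_addr.
move=> /leq_trans; apply; apply: leq_sum => k _; apply: leq_sum => z _.
rewrite -{1}[n](@subnK k.+1); last exact: leq_trans (ltn_ord k) le_bn.
exact: count_walks_between.
Qed.

(** By induction, each of the at most [b * q] terms of the union bound is at most [D ^ n.-1] once
    scaled by [2 ^ k]; then [2 * b * q <= D] yields one more factor 2. *)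
Lemma count_ends_halves N k n t :
  (forall m, b <= m <= N -> all blocked (walks m)) -> k * b <= n <= N ->
  2 ^ k * count (ends_at t) (walks n) <= D ^ n.
Proof.
move=> bl; elim: k n t => [|k IHk] n t /andP[kbn nN].
  by rewrite mul1n -size_walks count_size.
have bn: b <= n by rewrite (leq_trans _ kbn) // mulSn leq_addr.
have := count_blocked t bn (bl n _); rewrite bn nN => /(_ isT) le_t.
have [n0|n_gt0] := posnP n.
  have b0: b = 0 by lia.
  by move: le_t; rewrite b0 big_ord0 leqn0 => /eqP ->; rewrite muln0.
rewrite expnS -mulnA (leq_trans (leq_mul (leqnn 2) (leq_mul (leqnn _) le_t))) //.
rewrite -[in leqRHS](prednK n_gt0) expnS (leq_trans _ (leq_mul leZD (leqnn _))) // -!mulnA leq_mul //.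
have ->: b * (q * D ^ n.-1) = \sum_(j < b) q * D ^ n.-1.
  by rewrite sum_nat_const card_ord.
rewrite big_distrr; apply: leq_sum => j _ /=; rewrite big_distrr /=.
have jb := ltn_ord j.
apply: (@leq_trans (\sum_(z in Z t) D ^ n.-1)); last by rewrite sum_nat_const leq_mul.
apply: leq_sum => z _; rewrite mulnCA.
have /(leq_mul (leqnn (D ^ j))) le_j := IHk (n - j.+1) z ltac:(lia).
by apply: leq_trans le_j _; rewrite -expnD leq_pexp2l //; lia.
Qed.

(** Otherwise each vertex would end at most one in [2 ^ #|V|] of the walks with [N] steps; summing
    over all vertices contradicts [#|V| < 2 ^ #|V|]. *)
Lemma unblocked_walk : exists h, [/\ good h, b < size h & ~~ blocked h].
Proof.
(* Long enough for [#|V|] halvings, one per [b] steps. *)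
pose N := #|V| * b.
have [/forallP bl|] := boolP [forall n : 'I_N.+1, (b <= n) ==> all blocked (walks n)].
  have bl' m : b <= m <= N -> all blocked (walks m).
    by move=> /andP[bm mN]; have := bl (Ordinal (mN : m < N.+1)); rewrite /= bm.
  have le_sum: 2 ^ #|V| * \sum_t count (ends_at t) (walks N) <= #|V| * D ^ N.
    rewrite big_distrr -sum_nat_const; apply: leq_sum => t _ /=.
    by apply: count_ends_halves bl' _; rewrite leqnn.
  have eq_sum: \sum_t count (ends_at t) (walks N) = D ^ N.
    rewrite -size_walks -sum1_size.
    under eq_bigr => t _ do rewrite -sum1_count big_mkcond.
    rewrite exchange_big /=; apply: eq_bigr => h _.
    by rewrite -big_mkcond /= (big_pred1 (head x0 h)) // => t; rewrite /ends_at /= eq_sym.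
  by move: le_sum; rewrite eq_sum leq_pmul2r ?expn_gt0 ?D_gt0 // leqNgt ltn_expl.
rewrite negb_forall => /existsP[n]; rewrite negb_imply => /andP[bn /allPn[h /walks_good]].
by case/andP=> gh /eqP sh nbl; exists h; rewrite sh ltnS.
Qed.

End Walks.

Lemma card_bigcup_le (I : Type) (V : finType) (s : seq I) (F : I -> {set V}) :
  #|\bigcup_(i <- s) F i| <= \sum_(i <- s) #|F i|.
Proof.
apply: (big_ind2 (fun (A : {set V}) k => #|A| <= k)) => [|A x B y Ax By|//].
  by rewrite cards0.
by rewrite (leq_trans (leq_card_setU _ _).1) // leq_add.
Qed.

(** * A path avoiding small sets attached to its two ends *)

Section UnblockedPath.
Variables (V : finType) (e : rel V) (T : {set V}) (b q : nat) (Zp Zm : V -> {set V}).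

Let shuns y x := (y != x) && (y \notin Zp x).

(** Memory is limited to [b] vertices, which bounds the number of vertices forbidden at each
    step. *)
Fixpoint locally_shunning h :=
  if h is y :: h' then all (shuns y) (take b h') && locally_shunning h' else true.

Lemma pairwise_shuns h : locally_shunning h -> pairwise shuns (take b.+1 h).
Proof.
elim: h => //= y h IHh /andP[-> /IHh]; apply: subseq_pairwise.
by rewrite -(take_takel h (leqnSn b)) take_subseq.
Qed.

(** The path is the last [b] steps of an unblocked walk in [T]: the walk rule enforces avoidance of
    [Zp], and being unblocked gives avoidance of [Zm]. The degree covers [b * q.+1] forbidden
    vertices and [2 * b * q] admissible ones. *)
Lemma unblocked_path : 0 < b -> 0 < q -> T != set0 ->
  (forall v, #|Zp v| <= q) -> (forall v, #|Zm v| <= q) ->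
  (forall x, x \in T -> b * q.+1 + 2 * b * q <= #|[set y in T | e x y]|) ->
  exists x s, [/\ size s = b, path e x s, uniq (x :: s) & {subset x :: s <= T}] /\
    {in s, forall v, v \notin Zp x} /\ {in belast x s, forall v, v \notin Zm (last x s)}.
Proof.
move=> b_gt0 q_gt0 /set0Pn[x0 Tx0] cardZp cardZm deg_e.
pose D := 2 * b * q.
pose free h := [set y in T | e (head x0 h) y] :\: \bigcup_(z <- take b h) (z |: Zp z).
(* Truncation gives all walks the same number of extensions. *)
pose out h := take D (enum (free h)).
pose good h := [&& h != [::], all (mem T) h, sorted (fun y x => e x y) h
                 & locally_shunning h].
have good0 : good [:: x0] by rewrite /good /= Tx0.
have goodS h : good h ->
    [/\ uniq (out h), size (out h) = D & forall y, y \in out h -> good (y :: h)].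
  move=> gh; split; first by rewrite take_uniq ?enum_uniq.
    have Th : head x0 h \in T by case: h gh => //= x h /and4P[_ /andP[]].
    pose B := \bigcup_(z <- take b h) (z |: Zp z).
    have le_B : #|B| <= b * q.+1.
      apply: leq_trans (card_bigcup_le _ _) _.
      apply: (@leq_trans (\sum_(z <- take b h) q.+1)).
        by apply: leq_sum => z _; rewrite cardsU1 -add1n leq_add ?leq_b1.
      by rewrite big_const_seq count_predT iter_addn_0 mulnC leq_mul // size_take_min geq_minl.
    rewrite size_takel // -cardE cardsD; have := deg_e _ Th; rewrite -/B -/D.
    by have := subset_leq_card (subsetIr [set y in T | e (head x0 h) y] B); lia.
  move=> y /mem_take; rewrite mem_enum !inE => /and3P[fy Ty exy].
  case: h gh fy exy => //= x h; rewrite /good => /and4P[_ Th eh sh] fy exy.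
  apply/and4P; split=> //=; [by rewrite Ty | by rewrite exy | apply/andP; split=> //].
  apply/allP => z zh; apply: contraR fy; rewrite negb_and !negbK => zy.
  by rewrite bigcup_seq; apply/bigcupP; exists z; rewrite // !inE.
have D_gt0 : 0 < D by rewrite !muln_gt0 b_gt0 q_gt0.
have [h [/and4P[_ Th eh /pairwise_shuns]]] := unblocked_walk good0 goodS D_gt0 (leqnn D) cardZm.
move: Th eh; case: h => //= t h /andP[Tt /allP Th] eh pw; rewrite ltnS => bh nbl.
have szh : size (take b h) = b by rewrite size_takel.
have Zt v : v \in take b h -> v \notin Zm t.
  move=> vh; apply: contra nbl => vZ; apply/existsP.
  have vb : index v h < b by rewrite index_ltn.
  exists (Ordinal vb); rewrite /= -nth0 nth_drop addn0 nth_index //.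
  exact: mem_take vh.
have Thb v : v \in take b h -> v \in T by move/mem_take/Th.
have ehb : path (fun y x => e x y) t (take b h) by rewrite take_path.
case/lastP: (take b h) szh pw Zt Thb ehb => [/esym/eqP|u x]; first by rewrite -leqn0 leqNgt b_gt0.
rewrite size_rcons => szu; rewrite -pairwise_cons -rcons_cons pairwise_rcons => /andP[/allP ux pu] Zt Thb eu.
exists x, (rcons (rev u) t); rewrite belast_rcons last_rcons; split; first split.
- by rewrite size_rcons size_rev.
- by move: eu; rewrite -rev_path last_rcons belast_rcons rev_cons.
- have: pairwise (fun y x => y != x) (rcons (t :: u) x).
    rewrite pairwise_rcons; apply/andP; split.
      by apply/allP => y /ux /andP[].
    by apply: sub_pairwise pu => y z /andP[].
  by rewrite -uniq_pairwise -rev_uniq rev_rcons rev_cons.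
- move=> v; rewrite inE mem_rcons inE mem_rev => /or3P[/eqP->|/eqP->//|vu].
    by rewrite Thb // mem_rcons mem_head.
  by rewrite Thb // mem_rcons inE vu orbT.
split=> v; first by rewrite mem_rcons inE mem_rev => vu; have /andP[] := ux v vu.
by rewrite inE mem_rev => vu; apply: Zt; rewrite mem_rcons inE.
Qed.

End UnblockedPath.

(** * Robust families and alternating chains of paths *)

Section Robust.
Variables (P V : finType) (supp : P -> {set V}) (en : bool -> P -> V) (q : nat).

(* [en false] and [en true] stand for the first and the last vertex of a path. *)
Definition robust (F : {set P}) := forall c p (Z : {set V}),
  p \in F -> #|Z| <= q -> en c p \notin Z ->
  exists2 p', p' \in F & en c p' = en c p /\ [disjoint supp p' & Z].

(** Induction on [#|F|]. If [Z0] blocks all members sharing one end, these are deleted; sets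
    blocking the remainder, completed by [Z0] at that end, would block all of [F], so the hypothesis
    is inherited. *)
Lemma robust_subfamily (F : {set P}) :
  (forall Z : bool -> V -> {set V},
     (forall c v, #|Z c v| <= q /\ v \notin Z c v) ->
     exists2 p, p \in F & forall c, [disjoint supp p & Z c (en c p)]) ->
  exists2 F' : {set P}, F' \subset F & F' != set0 /\ robust F'.
Proof.
have [n] := ubnP #|F|; elim: n F => // n IHn F leFn unbl.
have [rob|] := boolP [forall c, forall p in F, forall Z : {set V},
  (#|Z| <= q) && (en c p \notin Z) ==>
  [exists p' in F, (en c p' == en c p) && [disjoint supp p' & Z]]].
  exists F => //; split.
    have [|p Fp _] := unbl (fun _ _ => set0); last by apply/set0Pn; exists p.
    by move=> c v; rewrite cards0 inE.
  move=> c p Z Fp qZ pZ; have /forallP/(_ c)/forall_inP/(_ p Fp)/forallP/(_ Z) := rob.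
  by rewrite qZ pZ => /exists_inP[p' Fp' /andP[/eqP]]; exists p'.
rewrite negb_forall => /existsP[c /forall_inPn[p0 Fp0]].
rewrite negb_forall => /existsP[Z0]; rewrite negb_imply => /andP[/andP[qZ0 p0Z0]].
move=> /exists_inPn hit; pose F1 := [set p in F | en c p != en c p0].
have F1F : F1 \subset F by apply/subsetP => p; rewrite inE => /andP[].
have ltF1 : #|F1| < n.
  rewrite -ltnS (leq_trans _ leFn) // ltnS proper_card //; apply/properP; split=> //.
  by exists p0; rewrite // inE eqxx andbF.
have [Z HZ|F' F'F1 ?] := IHn F1 ltF1; last by exists F'; rewrite // (subset_trans F'F1).
pose Z' c' v := if (c' == c) && (v == en c p0) then Z0 else Z c' v.
have [c' v|p Fp disj] := unbl Z'.
  by rewrite /Z'; case: ifP => // /andP[_ /eqP ->].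
have ne : en c p != en c p0.
  apply/eqP => epc; have := hit p Fp; rewrite epc eqxx /=.
  by have := disj c; rewrite /Z' epc !eqxx => ->.
exists p; first by rewrite inE Fp.
move=> c'; have := disj c'; rewrite /Z'; case: (c' =P c) => [->|//].
by rewrite (negbTE ne).
Qed.

(** Greedy: by robustness, each new path avoids all used vertices but the joint. Joints are
    alternately first and last vertices, so consecutive paths have opposite directions along the
    chain. *)
Lemma alternating_chain (F : {set P}) k m :
  robust F -> F != set0 ->
  (forall p, p \in F -> #|supp p| <= k) -> m * k <= q ->
  (forall p, p \in F -> en false p != en true p) ->
  (forall c p, en c p \in supp p) ->
  exists p : nat -> P, [/\ forall i, i <= m -> p i \in F,
    forall i, i < m -> en (odd i) (p i.+1) = en (odd i) (p i) &
    forall i j v, i < j <= m -> v \in supp (p i) -> v \in supp (p j) ->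
      j = i.+1 /\ v = en (odd i) (p i)].
Proof.
move=> rob /set0Pn[p0 Fp0] suppk mkq ends en_supp.
elim: m mkq => [|m IHm] mkq.
  by exists (fun=> p0); split=> // i j v ij; lia.
have [|p [pF pj pd]] := IHm; first by rewrite (leq_trans _ mkq) // mulSn leq_addl.
pose Z := (\bigcup_(j < m.+1) supp (p j)) :\ en (odd m) (p m).
have [||p1 Fp1 [p1m p1Z]] := @rob (odd m) (p m) Z (pF _ (leqnn m)).
- apply: leq_trans mkq; apply: leq_trans (subset_leq_card (subsetDl _ _)) _.
  apply: leq_trans (card_bigcup_le _ _) _; rewrite -[X in X * k]card_ord -sum_nat_const.
  by apply: leq_sum => j _; rewrite suppk // pF // -ltnS.
- by rewrite !inE eqxx.
exists (fun i => if i <= m then p i else p1); split.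
- by move=> i _; case: ifP => // /pF.
- rewrite /= => i; rewrite ltnS => im; rewrite im; case: ltnP => [lt_im|]; first exact: pj.
  by rewrite leqNgt => ?; have -> : i = m by lia.
move=> i j v /andP[ij jm] vi; have im : i <= m by lia.
case: leqP => [jm'|mj]; first by rewrite im in vi *; apply: pd vi; lia.
rewrite im in vi * => vp1; have ->: j = m.+1 by lia.
have vm : v = en (odd m) (p m).
  apply/eqP; apply: contraTT p1Z => nv; apply/pred0Pn; exists v; rewrite /= vp1 inE !inE nv.
  by apply/bigcupP; exists (Ordinal (im : i < m.+1)).
have [->|ne_im] := eqVneq i m; first by [].
(* If the joint also lay on an earlier path, it would be both ends of [p m], by parity. *)
have [||mi vi'] := pd i m v _ vi _; [by lia | by rewrite vm en_supp |].
have := pj i; rewrite -mi leqnn => /(_ isT) eim.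
have /eqP[] := ends _ (pF m (leqnn m)).
move: vm; rewrite vi' -eim mi /=; case: (odd i) => //= <-.
Qed.

End Robust.

(** * Making two walks meet outside a small set *)

Section Meeting.
Variables (V : finType) (E : rel V).

Definition out_boundary (X : {set V}) := [set y | (y \notin X) && [exists x in X, E x y]].

Lemma minimal_boundary_set M : 0 < #|V| ->
  exists T : {set V}, [/\ T != set0, #|out_boundary T| <= M &
    forall X : {set V}, X != set0 -> X \proper T -> M < #|out_boundary X|].
Proof.
move=> V_gt0; pose small (X : {set V}) := (X != set0) && (#|out_boundary X| <= M).
have smallT : small setT.
  apply/andP; split; first by rewrite -card_gt0 cardsT.
  by rewrite (_ : out_boundary _ = set0) ?cards0 //; apply/setP => y; rewrite !inE.
case: (arg_minnP (fun X : {set V} => #|X|) smallT) => T /andP[T0 TM] Tmin.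
exists T; split=> // X X0 XT; rewrite ltnNge; apply/negP => XM.
by have := Tmin X; rewrite /small X0 XM leqNgt proper_card // => /(_ isT).
Qed.

(** Without in-neighbours, [u1] and [u2] cannot lie on each other's paths, so [v] comes after both
    starts. The second path is cut at its first vertex [w] on the first path, and the first path is
    cut at [w] too. *)
Lemma joint_descendant_paths (e : rel V) u1 u2 v :
  (forall x, ~~ e x u1) -> (forall x, ~~ e x u2) -> u1 != u2 ->
  connect e u1 v -> connect e u2 v ->
  exists A B w, [/\ path e u1 (rcons A w), path e u2 (rcons B w) & uniq (rcons A w ++ B)].
Proof.
move=> src1 src2 u12 /connectP[p1 e1 v1] /connectP[p2 e2 v2].
have no_in u x p : (forall y, ~~ e y u) -> path e x p -> u \notin p.
  move=> srcu; elim: p x => //= y p IHp x /andP[exy /IHp]; rewrite inE negb_or => ->.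
  by rewrite andbT; apply: contraTneq exy => <-.
case/shortenP: e1 v1 => {}p1 e1 /= /andP[_ up1] _ v1.
case/shortenP: e2 v2 => {}p2 e2 /= /andP[_ up2] _ v2.
have p1v : v \in p1.
  case/lastP: p1 {e1 up1} v1 => [/= v1|p x ->]; last by rewrite last_rcons mem_rcons mem_head.
  case/lastP: p2 {up2} e2 v2 => [_ /= v2|p x epx]; first by rewrite -v1 v2 eqxx in u12.
  rewrite last_rcons => vx; have := no_in _ _ _ src1 epx.
  by rewrite mem_rcons inE -v1 vx eqxx.
have p2v : v \in p2.
  case/lastP: p2 {e2 up2} v2 => [/= v2|p x ->]; last by rewrite last_rcons mem_rcons mem_head.
  by have := no_in _ _ _ src2 e1; rewrite -v2 p1v.
have has2 : has (mem p1) p2 by apply/hasP; exists v.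
case/split_find: has2 up2 e2 => w B s p1w hasB up2 e2.
have [A [s' def1]] : exists A s', p1 = rcons A w ++ s'.
  by case/splitPr: p1w => A s'; exists A, s'; rewrite cat_rcons.
exists A, B, w; split.
- by move: e1; rewrite def1 cat_path => /andP[].
- by move: e2; rewrite cat_path => /andP[].
rewrite cat_uniq; apply/and3P; split.
- by move: up1; rewrite def1 cat_uniq => /andP[].
- apply: contra hasB => /hasP[x xB xA]; apply/hasP; exists x => //=.
  by rewrite def1 mem_cat xA.
by move: up2; rewrite cat_uniq rcons_uniq => /andP[/andP[]].
Qed.

(** If the sets reached from [u1] and [u2] were disjoint, each would meet [T] in a proper subset,
    with more than [M] boundary vertices, all in [Q] or reached outside [T]. As [2 * #|Q| <= M],
    together they would contain more than [M] vertices of the boundary of [T]. *)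
Lemma meeting_paths (T Q : {set V}) M u1 u2 :
  #|out_boundary T| <= M ->
  (forall X : {set V}, X != set0 -> X \proper T -> M < #|out_boundary X|) ->
  2 * #|Q| <= M -> u1 \in T :&: Q -> u2 \in T :&: Q -> u1 != u2 ->
  exists A B w, [/\ path E u1 (rcons A w), path E u2 (rcons B w), uniq (rcons A w ++ B)
    & {in rcons A w ++ B, forall v, v \notin Q}].
Proof.
move=> TM Tmin QM /setIP[Tu1 Qu1] /setIP[Tu2 Qu2] u12.
(* Requiring tails in [T] puts all reached vertices outside [T] in its boundary; forbidding heads in
   [Q] makes [u1] and [u2] sources. *)
pose e x y := [&& E x y, x \in T & y \notin Q].
have src u : u \in Q -> forall x, ~~ e x u by move=> Qu x; rewrite /e Qu !andbF.
pose R u := [set v | connect e u v].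
have [disj|] := boolP [disjoint R u1 & R u2]; last first.
  case/pred0Pn => v /= /andP[]; rewrite !inE => c1 c2.
  have [A [B [w [eA eB uAB]]]] := joint_descendant_paths (src _ Qu1) (src _ Qu2) u12 c1 c2.
  have subE : subrel e E by move=> x y /and3P[].
  exists A, B, w; split=> //; try exact: sub_path subE _ _ _.
  have avoid u p : path e u p -> {in p, forall v, v \notin Q}.
    elim: p u => //= y p IHp u /andP[/and3P[_ _ Qy] /IHp IH] z.
    by rewrite inE => /orP[/eqP->|/IH].
  move=> z; rewrite mem_cat => /orP[|zB]; first exact: avoid eA _.
  by apply: (avoid _ _ eB); rewrite mem_rcons inE zB orbT.
have big u u' : u \in T -> u' \in T -> u' \notin R u -> M < #|Q| + #|R u :\: T|.
  move=> Tu Tu' Ru'; apply: leq_trans (leq_card_setU _ _).1.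
  apply: leq_trans (subset_leq_card _); first apply: (Tmin (R u :&: T)).
  - by apply/set0Pn; exists u; rewrite !inE connect0.
  - apply/properP; split; first exact: subsetIr.
    by exists u'; rewrite // inE (negbTE Ru').
  apply/subsetP => y; rewrite inE => /andP[Xy /exists_inP[x /setIP[Rx Tx] Exy]].
  rewrite in_setU; have [//|Qy /=] := boolP (y \in Q).
  have Ry : y \in R u.
    rewrite !inE in Rx *; apply: connect_trans Rx (connect1 _).
    by rewrite /e Exy Tx Qy.
  by move: Xy; rewrite !in_setI in_setD Ry /= => ->.
have R1 : u1 \notin R u2 by rewrite (disjointFr disj) // inE connect0.
have R2 : u2 \notin R u1 by rewrite (disjointFl disj) // inE connect0.
have sub u : u \in T -> R u :\: T \subset out_boundary T.
  move=> Tu; apply/subsetP => y; rewrite !inE => /andP[Ty /connectP[p ep yp]].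
  rewrite Ty; case/lastP: p ep yp => [_ /= yu|p x]; first by rewrite yu Tu in Ty.
  rewrite rcons_path last_rcons => /andP[_ /and3P[Ex Tx _]] ->.
  by apply/exists_inP; exists (last u p).
have : #|R u1 :\: T| + #|R u2 :\: T| <= M.
  have dW : [disjoint R u1 :\: T & R u2 :\: T].
    exact: disjointWl (subsetDl _ _) (disjointWr (subsetDl _ _) disj).
  have /eqP <- : #|R u1 :\: T :|: R u2 :\: T| == #|R u1 :\: T| + #|R u2 :\: T|.
    by rewrite (leq_card_setU _ _).2.
  by apply: leq_trans TM; rewrite subset_leq_card // subUset !sub.
have := big _ _ Tu1 Tu2 R2; have := big _ _ Tu2 Tu1 R1; lia.
Qed.

End Meeting.

(** * From long paths to a subdivision of the oriented cycle *)

Section Cab.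
Variables (a b : nat).
Hypotheses (a_gt1 : 1 < a) (b_gt0 : 0 < b).

Lemma Cab_pos_end (i : 'I_a) d : Cab_pos b i d b = inl (inr (if d then ordS i else i)).
Proof. by rewrite /Cab_pos leqnn; case: eqP b_gt0 => // ->. Qed.

Lemma Cab_pos_mid (i : 'I_a) d (j : 'I_b.-1) : Cab_pos b i d j.+1 = inr (i, d, j).
Proof.
rewrite /Cab_pos /= leqNgt (_ : j.+1 < b); last by have := ltn_ord j; lia.
by rewrite valK.
Qed.

Lemma ordS_neq (i : 'I_a) : ordS i != i.
Proof.
apply/eqP => /(congr1 val) /=; have := ltn_ord i.
rewrite leq_eqVlt => /orP[/eqP ia|ia]; last by rewrite modn_small //; lia.
by rewrite ia modnn; lia.
Qed.

(** The penultimate vertex determines [i]; the end then determines [d], since [ordS i] differs from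
    [i] for [a >= 2]. This lets [P] recover the path from its last arc. *)
Lemma Cab_last_arc_inj (i i' : 'I_a) d d' :
  Cab_pos b i d b.-1 = Cab_pos b i' d' b.-1 -> Cab_pos b i d b = Cab_pos b i' d' b ->
  (i, d) = (i', d').
Proof.
rewrite !Cab_pos_end => pred_eq [end_eq].
have ii : i = i'.
  case: (posnP b.-1) => [b0|b1].
    have pos0 (i1 : 'I_a) d1 : Cab_pos b i1 d1 b.-1 = inl (inl i1) by rewrite /Cab_pos; case: eqP.
    by move: pred_eq; rewrite !pos0 => -[].
  have lt : b.-1.-1 < b.-1 by lia.
  have pos_mid (i1 : 'I_a) d1 : Cab_pos b i1 d1 b.-1 = inr (i1, d1, Ordinal lt).
    by have := Cab_pos_mid i1 d1 (Ordinal lt); rewrite [val _]/= (prednK b1).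
  by move: pred_eq; rewrite !pos_mid => -[].
subst i'; congr (_, _).
by case: d d' end_eq {pred_eq} => -[] // /eqP; rewrite ?(negPf (ordS_neq i)) // eq_sym (negPf (ordS_neq i)).
Qed.

Variables (V : finType) (E : rel V).
Variables (src tgt : 'I_a -> V) (inner : 'I_a -> bool -> seq V).
Hypotheses (inner_path : forall i d,
    path E (src i) (rcons (inner i d) (tgt (if d then ordS i else i))))
  (inner_uniq : forall i d, uniq (inner i d))
  (inner_size : forall i d, b <= (size (inner i d)).+1)
  (src_inj : injective src) (tgt_inj : injective tgt)
  (src_tgt : forall i j, src i != tgt j)
  (inner_src : forall i d v, v \in inner i d -> forall j, v != src j)
  (inner_tgt : forall i d v, v \in inner i d -> forall j, v != tgt j)
  (inner_inj : forall i d i' d' v, v \in inner i d -> v \in inner i' d' -> (i, d) = (i', d')).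

Let phi (u : Cab_vert a b) : V :=
  match u with
  | inl (inl i) => src i
  | inl (inr i) => tgt i
  | inr (i, d, j) => nth (src i) (inner i d) j
  end.

(** The first [b.-1] inner vertices are already images under [phi], so the last arc carries all
    surplus length; [pick] finds the path ending with the arc [(x, y)]. *)
Let P (x y : Cab_vert a b) : seq V :=
  if [pick id : 'I_a * bool |
       (Cab_pos b id.1 id.2 b.-1 == x) && (Cab_pos b id.1 id.2 b == y)] is Some id
  then drop b.-1 (inner id.1 id.2) else [::].

Lemma phi_pos i d k : k < b -> phi (Cab_pos b i d k) = nth (src i) (src i :: inner i d) k.
Proof.
case: k => // k kb; have lt : k < b.-1 by lia.
by rewrite -[k]/(val (Ordinal lt)) Cab_pos_mid.
Qed.

Lemma P_arc i d k : k < b ->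
  P (Cab_pos b i d k) (Cab_pos b i d k.+1) = if k.+1 == b then drop b.-1 (inner i d) else [::].
Proof.
move=> kb; rewrite /P; case: eqP => [kb1|/eqP kb1].
  have -> : k = b.-1 by lia.
  rewrite prednK //; case: pickP => [[i' d'] /= /andP[/eqP e1 /eqP e2]|/(_ (i, d))].
    by have [-> ->] := Cab_last_arc_inj e1 e2.
  by rewrite /= !eqxx.
case: pickP => // -[i' d'] /= /andP[_ /eqP].
have lt : k < b.-1 by lia.
by rewrite Cab_pos_end -[k]/(val (Ordinal lt)) Cab_pos_mid.
Qed.

Lemma inner_ge i d : b.-1 <= size (inner i d).
Proof. by rewrite -ltnS prednK. Qed.

Lemma mem_inner i d (j : 'I_b.-1) : nth (src i) (inner i d) j \in inner i d.
Proof. exact/mem_nth/(leq_trans (ltn_ord j))/inner_ge. Qed.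

Lemma nth_inner_drop i d (j : 'I_b.-1) : nth (src i) (inner i d) j \notin drop b.-1 (inner i d).
Proof.
have := inner_uniq i d; rewrite -{1}(cat_take_drop b.-1 (inner i d)) cat_uniq.
case/and3P=> _ /hasPn dis _; apply/negP => /dis /negP; apply.
by rewrite -(nth_take (n0 := b.-1)) // mem_nth // size_takel ?inner_ge.
Qed.

Lemma phi_inj : injective phi.
Proof.
move=> [[i|i]|[[i d] j]] [[i'|i']|[[i' d'] j']] /= eq_phi.
- by rewrite (src_inj eq_phi).
- by have := src_tgt i i'; rewrite eq_phi eqxx.
- by have := inner_src (mem_inner i' d' j') i; rewrite eq_phi eqxx.
- by have := src_tgt i' i; rewrite eq_phi eqxx.
- by rewrite (tgt_inj eq_phi).
- by have := inner_tgt (mem_inner i' d' j') i; rewrite eq_phi eqxx.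
- by have := inner_src (mem_inner i d j) i'; rewrite eq_phi eqxx.
- by have := inner_tgt (mem_inner i d j) i'; rewrite eq_phi eqxx.
have mem' := mem_inner i' d' j'; rewrite -eq_phi in mem'.
have [ei ed] := inner_inj (mem_inner i d j) mem'; subst i' d'.
congr (inr (_, _, _)); apply: val_inj; apply/eqP.
have lt (k : 'I_b.-1) : k < size (inner i d) := leq_trans (ltn_ord k) (inner_ge i d).
by rewrite -(nth_uniq (src i) (lt j) (lt j') (inner_uniq i d)) eq_phi.
Qed.

Lemma last_take_nth (x x1 : V) s k : k <= size s -> last x (take k s) = nth x1 (x :: s) k.
Proof. by elim: s k x => [|y s IHs] [|k] x //=; apply: IHs. Qed.

Lemma contains_Cab : contains_subdivision (@Cab_rel a b) E.
Proof.
have arcP x y : Cab_rel x y ->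
    exists i d k, [/\ k < b, x = Cab_pos b i d k & y = Cab_pos b i d k.+1].
  case/existsP=> i /existsP[d /existsP[k /andP[/eqP <- /eqP <-]]].
  by exists i, d, k; split.
exists phi; split; first exact: phi_inj.
exists P; split=> [x y /arcP[i [d [k [kb -> ->]]]]|].
  rewrite P_arc // phi_pos //; case: eqP => [kb1|/eqP kb1].
    have -> : k = b.-1 by lia.
    rewrite prednK // Cab_pos_end; split.
    - have := inner_path i d; rewrite -{1}(cat_take_drop b.-1 (inner i d)) rcons_cat cat_path.
      by case/andP=> _; rewrite (last_take_nth _ (src i)) ?inner_ge.
    - exact: drop_uniq (inner_uniq i d).
    move=> v vdrop; have vint := mem_drop vdrop.
    move=> [[j|j]|[[i' d'] j]] /=; [exact: inner_src vint _|exact: inner_tgt vint _|].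
    apply: contraTneq vdrop => v_nth; rewrite v_nth in vint *.
    by have [-> ->] := inner_inj vint (mem_inner i' d' j); rewrite nth_inner_drop.
  split=> //=; rewrite phi_pos ?andbT; last by lia.
  have ks : k < size (inner i d) by apply: leq_trans (inner_ge i d); lia.
  have /(pathP (src i))/(_ k) := inner_path i d.
  by rewrite size_rcons ltnW // -rcons_cons !nth_rcons /= ks ltnW // => /(_ isT).
move=> x y x' y' /arcP[i [d [k [kb -> ->]]]] /arcP[i' [d' [k' [kb' -> ->]]]] ne v.
rewrite !P_arc //; case: eqP => // k1 /mem_drop vi; case: eqP => // k1'.
apply/negP => /mem_drop vi'; have [ei ed] := inner_inj vi vi'.
by case/negP: ne; rewrite ei ed (_ : k = k') //; lia.
Qed.

End Cab.

(** Blocks [i.*2] and [i.*2.+1] share a source, and blocks [i.*2.+1] and [i.+1.*2] a sink,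
    cyclically. By the parity clause even blocks are disjoint, so their ends are injective choices
    of the [s_i] and [t_i]. *)
Lemma closed_chain_subdivision (V : finType) (E : rel V) a b (X W : nat -> V) (J : nat -> seq V) :
  1 < a -> 0 < b ->
  (forall k, k < a.*2 -> [/\ path E (X k) (rcons (J k) (W k)), uniq (X k :: rcons (J k) (W k))
     & b <= (size (J k)).+1]) ->
  (forall i, i < a -> X i.*2.+1 = X i.*2 /\ W i.*2.+1 = W (i.+1 %% a).*2) ->
  (forall j k v, j < a.*2 -> k < a.*2 -> j != k ->
     v \in X j :: rcons (J j) (W j) -> v \in X k :: rcons (J k) (W k) ->
     odd j != odd k /\ (v = X j /\ v = X k \/ v = W j /\ v = W k)) ->
  contains_subdivision (@Cab_rel a b) E.
Proof.
move=> a_gt1 b_gt0 blk joint meet.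
pose idx (i : 'I_a) (d : bool) := i.*2 + d.
have idx_lt i d : idx i d < a.*2 by rewrite /idx; have := ltn_ord i; case: d; lia.
have idx_inj i d i' d' : idx i d = idx i' d' -> (i, d) = (i', d').
  rewrite /idx => e; have ed : d = d' by case: d d' e => -[] //; lia.
  by rewrite ed; congr (_, _); apply: val_inj => /=; rewrite ed in e; lia.
have meet_end i d k v : k < a.*2 -> v \in J (idx i d) ->
    v \in X k :: rcons (J k) (W k) -> k = idx i d.
  move=> ka vJ vk; apply/eqP; apply: contraT => ne.
  have [_ /= /andP[XJ WJ] _] := blk _ (idx_lt i d).
  have vi : v \in X (idx i d) :: rcons (J (idx i d)) (W (idx i d)).
    by rewrite inE mem_rcons inE vJ !orbT.
  have [_ [[_ vX]|[_ vW]]] := meet _ _ _ ka (idx_lt i d) ne vk vi.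
    by move: XJ; rewrite -vX mem_rcons inE vJ orbT.
  by move: WJ; rewrite rcons_uniq -vW vJ.
have even_inj (i i' : 'I_a) v : v \in X i.*2 :: rcons (J i.*2) (W i.*2) ->
    v \in X i'.*2 :: rcons (J i'.*2) (W i'.*2) -> i = i'.
  have lt2 (i1 : 'I_a) : i1.*2 < a.*2 by rewrite ltn_double.
  move=> vi vi'; apply: val_inj; apply/eqP; apply: contraT => ne.
  have ne2 : i.*2 != i'.*2 by apply: contra ne => /eqP/double_inj/eqP.
  by have [] := meet _ _ v (lt2 i) (lt2 i') ne2 vi vi'; rewrite !odd_double.
have memX k : X k \in X k :: rcons (J k) (W k) by rewrite mem_head.
have memW k : W k \in X k :: rcons (J k) (W k) by rewrite inE mem_rcons mem_head orbT.
apply: (@contains_Cab a b a_gt1 b_gt0 V E (fun i => X i.*2) (fun i => W i.*2)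
  (fun i d => J (idx i d))).
- move=> i d; have [+ _ _] := blk _ (idx_lt i d); have [XX WW] := joint i (ltn_ord i).
  by rewrite /idx; case: d; rewrite ?addn1 ?addn0 ?XX ?WW.
- by move=> i d; have [_ /= /andP[_]] := blk _ (idx_lt i d); rewrite rcons_uniq => /andP[].
- by move=> i d; have [] := blk _ (idx_lt i d).
- by move=> i i' /= e; apply: (even_inj _ _ (X i.*2)); rewrite ?memX // e memX.
- by move=> i i' /= e; apply: (even_inj _ _ (W i.*2)); rewrite ?memW // e memW.
- move=> i j /=; apply/eqP => e; have ij : i = j by apply: (even_inj _ _ (X i.*2)); rewrite // e.
  have [_ /= /andP[+ _] _] := blk j.*2 ltac:(by rewrite ltn_double).
  by move: e; rewrite ij => ->; rewrite mem_rcons mem_head.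
- move=> i d v vJ j; apply/eqP => vX; rewrite /= in vX.
  have eX : X j.*2 = X (idx i d).
    have lt : j.*2 < a.*2 by rewrite ltn_double.
    by rewrite -(meet_end i d j.*2 v lt vJ) // vX.
  have [_ /= /andP[+ _] _] := blk _ (idx_lt i d).
  by rewrite -eX -vX mem_rcons inE vJ orbT.
- move=> i d v vJ j; apply/eqP => vW; rewrite /= in vW.
  have eW : W j.*2 = W (idx i d).
    have lt : j.*2 < a.*2 by rewrite ltn_double.
    by rewrite -(meet_end i d j.*2 v lt vJ) // vW.
  have [_ /= /andP[_ +] _] := blk _ (idx_lt i d).
  by rewrite rcons_uniq -eW -vW vJ.
move=> i d i' d' v vJ vJ'; apply/idx_inj/(meet_end _ _ _ v _ vJ') => //.
by rewrite inE mem_rcons inE vJ !orbT.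
Qed.

(** * Closing a robust chain into the oriented cycle *)

Section Main.
Variables (V : finType) (E : rel V) (a b : nat).
Hypotheses (a_gt1 : 1 < a) (b_gt0 : 0 < b).

(* The triple consists of the first vertex, the interior and the last vertex. *)
Let bpath : finType := (V * b.-1.-tuple V * V)%type.
Let vseq (p : bpath) : seq V := p.1.1 :: rcons p.1.2 p.2.
Let supp (p : bpath) := [set v in vseq p].
Let en (c : bool) (p : bpath) := if c then p.2 else p.1.1.
Let wf (T : {set V}) (p : bpath) :=
  [&& path E p.1.1 (rcons p.1.2 p.2), uniq (vseq p) & all (mem T) (vseq p)].

(** Sets attached to first vertices act as [Zp], those attached to last vertices as [Zm];
    [unblocked_path] shows that they miss some path of length [b]. *)
Lemma robust_paths (T : {set V}) q : 0 < q -> T != set0 ->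
  (forall x, x \in T -> b * q.+1 + 2 * b * q <= #|[set y in T | E x y]|) ->
  exists2 F : {set bpath}, F != set0 /\ robust supp en q F & forall p, p \in F -> wf T p.
Proof.
move=> q_gt0 T0 degT.
have [Z HZ|F FT ?] := @robust_subfamily _ _ supp en q [set p | wf T p]; last first.
  by exists F => // p /(subsetP FT); rewrite inE.
have [||x [s [[szs es us sT] [sZ tZ]]]] :=
    @unblocked_path _ E T b q (Z false) (Z true) b_gt0 q_gt0 T0 _ _ degT.
- by move=> v; have [] := HZ false v.
- by move=> v; have [] := HZ true v.
case/lastP: s => [|s y] in szs es us sT sZ tZ *; first by move: b_gt0; rewrite -szs.
rewrite size_rcons in szs; rewrite last_rcons belast_rcons in tZ.
have szs' : size s == b.-1 by rewrite -szs.
exists (x, Tuple szs', y); first by rewrite inE; apply/and3P; split=> //; apply/allP.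
move=> c; rewrite disjoint_subset; apply/subsetP => v; rewrite inE.
rewrite -[vseq _]/(x :: rcons s y) => vp; rewrite inE /=; case: c => /=.
  move: vp; rewrite -rcons_cons mem_rcons inE => /orP[/eqP->|/tZ //].
  by have [] := HZ true y.
move: vp; rewrite inE => /orP[/eqP->|/sZ //].
by have [] := HZ false x.
Qed.

(** As [m] is odd, both free ends of the chain are last vertices; [A] and [B] prolong the extreme
    paths to a common sink [w], which closes the cycle. *)
Lemma contains_Cab_of_chain m (p : nat -> bpath) (A B : seq V) w :
  m.+1 = a.*2 ->
  (forall k, k <= m -> path E (p k).1.1 (rcons (p k).1.2 (p k).2) /\ uniq (vseq (p k))) ->
  (forall k, k < m -> en (odd k) (p k.+1) = en (odd k) (p k)) ->
  (forall j k v, j < k <= m -> v \in supp (p j) -> v \in supp (p k) ->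
     k = j.+1 /\ v = en (odd j) (p j)) ->
  path E (p 0).2 (rcons A w) -> path E (p m).2 (rcons B w) -> uniq (rcons A w ++ B) ->
  (forall v k, v \in rcons A w ++ B -> k <= m -> v \notin supp (p k)) ->
  contains_subdivision (@Cab_rel a b) E.
Proof.
move=> ma pE pj pd eA eB uAB avoid.
have [uA dAB uB] := and3P (etrans (esym (cat_uniq _ _)) uAB).
pose X k := (p k).1.1; pose I k : seq V := (p k).1.2; pose Y k := (p k).2.
pose J k := if k == 0 then I 0 ++ Y 0 :: A else if k == m then I m ++ Y m :: B else I k.
pose W k := if (k == 0) || (k == m) then w else Y k.
have m_odd : odd m by rewrite -[odd m]negbK -[~~ odd m]/(odd m.+1) ma odd_double.
(* The first and the last path are prolonged, along A and B, to the meeting vertex w. *)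
have block k : k <= m -> exists C : seq V,
    [/\ X k :: rcons (J k) (W k) = vseq (p k) ++ C, path E (Y k) C, uniq C,
        {in C, forall v i, i <= m -> v \notin vseq (p i)} & {subset C <= if k == 0 then rcons A w else
          if k == m then rcons B w else [::]}].
  move=> km; rewrite /J /W; case: (k =P 0) => [->|_] /=.
    exists (rcons A w); split=> // [|v vA i im]; first by rewrite rcons_cat /= -cat_rcons.
    by have := avoid v i; rewrite inE mem_cat vA; apply.
  case: (k =P m) => [->|_]; last by exists [::]; rewrite cats0.
  exists (rcons B w); split=> // [||v].
  - by rewrite rcons_cat /= -cat_rcons.
  - rewrite rcons_uniq uB andbT; apply: contra dAB => wB; apply/hasP; exists w => //.
    by rewrite /= mem_rcons mem_head.
  move=> vB i im; have := avoid v i; rewrite inE mem_cat; apply=> //.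
  by move: vB; rewrite !mem_rcons !inE => /orP[->|->]; rewrite ?orbT.
apply: (@closed_chain_subdivision V E a b X W J a_gt1 b_gt0).
- move=> k km; have {}km : k <= m by rewrite -ltnS ma.
  have [C [eqC eC uC avC _]] := block k km.
  have [ek uk] := pE k km; split.
  + have : path E (X k) (rcons (I k) (Y k) ++ C) by rewrite cat_path ek last_rcons.
    by move: eqC; rewrite /vseq cat_cons => -[->].
  + rewrite eqC cat_uniq uk uC andbT; apply/hasPn => v /avC; exact.
  rewrite (@leq_trans (size (I k)).+1) //; first by rewrite size_tuple prednK.
  by rewrite /J; case: eqP => [->|_]; [|case: eqP => [->|_]]; rewrite ?size_cat ?leq_addr.
- move=> i ia; have lt2 : i.*2 < m by lia.
  have ne0 : (i.*2 == m) = false by apply/negP => /eqP; lia.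
  split; first by have := pj _ lt2; rewrite odd_double.
  move: ia; rewrite leq_eqVlt => /orP[/eqP ia|ia].
    by rewrite -ia modnn /W /= (_ : i.*2.+1 = m) ?eqxx ?orbT //; lia.
  rewrite modn_small // /W /=.
  have -> : (i.*2.+1 == m) = false by apply/negP => /eqP; lia.
  have -> : (i.+1.*2 == m) = false by apply/negP => /eqP; lia.
  have lt3 : i.*2.+1 < m by lia.
  by have := pj _ lt3; rewrite /= odd_double /= => /esym.
suff meet j k v : j < k -> k <= m -> v \in X j :: rcons (J j) (W j) ->
    v \in X k :: rcons (J k) (W k) ->
    odd j != odd k /\ (v = X j /\ v = X k \/ v = W j /\ v = W k).
  move=> j k v jm km; have {}jm : j <= m by rewrite -ltnS ma.
  have {}km : k <= m by rewrite -ltnS ma.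
  case: ltngtP => // [jk|kj] _ vj vk; first exact: meet.
  have [ne jn] := meet k j v kj jm vk vj; rewrite eq_sym; split=> //.
  by case: jn => -[]; [left|right].
move=> jk km; have jm : j <= m by lia.
have [C [-> _ _ avC subC]] := block j jm; have [C' [-> _ _ avC' subC']] := block k km.
rewrite !mem_cat.
case/orP=> [vj|vC] /orP[vk|vC'].
- have vsj : v \in supp (p j) by rewrite inE.
  have vsk : v \in supp (p k) by rewrite inE.
  have [|kj ev] := pd j k v _ vsj vsk; first by rewrite jk.
  split; first by rewrite kj /=; case: (odd j).
  have := pj j; rewrite -kj => /(_ km); rewrite /en in ev *; move: ev.
  case: ifP => [j_odd|_] ev ej; last by left; split=> //; rewrite ev -ej.
  (* An odd joint is a shared last vertex. Neither block is extreme, as [k = j.+1] is even and [m]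
     odd, so [W] is the original last vertex of both. *)
  have [j0 k0] : j != 0 /\ k != 0 by split; apply/eqP => z; rewrite z // in kj j_odd.
  have jm' : j != m by rewrite ltn_eqF // -kj.
  have km' : k != m.
    by apply/eqP => e; move: m_odd; rewrite -e kj /= j_odd.
  by right; rewrite /W (negPf j0) (negPf k0) (negPf jm') (negPf km') ev -ej.
- by have := avC' v vC' j jm; rewrite vj.
- by have := avC v vC k km; rewrite vk.
(* Only extreme blocks are prolonged, so [j = 0] and [k = m], and the prolongations meet only at
   [w]. *)
have k0 : k != 0 by rewrite -lt0n (leq_ltn_trans _ jk).
have := subC' v vC'; rewrite (negPf k0); case: (k =P m) => // ekm.
have := subC v vC; case: (j =P 0) => [j0|_]; last first.
  by case: (j =P m) => // ejm; rewrite ekm ejm ltnn in jk.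
rewrite j0 ekm m_odd /W !eqxx orbT => vA vB; split=> //; right.
suff -> : v = w by [].
move: vB; rewrite mem_rcons inE => /orP[/eqP //|vB].
by case/hasP: dAB; exists v.
Qed.

Lemma subdivision_Cab : 0 < #|V| -> min_outdeg_ge E (21 * a * b ^ 2) ->
  contains_subdivision (@Cab_rel a b) E.
Proof.
(* The chain has at most [2a(b+1) <= q] vertices, and [M = 2q] lets it serve as [Q]. A vertex of [T]
   has at most [M] out-neighbours outside [T], and [b(q+1) + 2bq + M = 12ab^2 + b + 8ab <=
   21ab^2]. *)
move=> V_gt0 degE; pose q := 4 * a * b; pose M := 2 * q.
have [T [T0 TM Tmin]] := minimal_boundary_set E M V_gt0.
have q_gt0 : 0 < q by rewrite !muln_gt0 b_gt0 (ltnW a_gt1).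
have degT x : x \in T -> b * q.+1 + 2 * b * q <= #|[set y in T | E x y]|.
  move=> Tx; have := degE x; have le_b : b <= a * b ^ 2.
    by rewrite -mulnn mulnA leq_pmull // muln_gt0 b_gt0 ltnW.
  have sub : [set y | E x y] \subset [set y in T | E x y] :|: out_boundary E T.
    apply/subsetP => y; rewrite !inE => Exy; rewrite Exy andbT.
    by case: (y \in T) => //=; apply/exists_inP; exists x.
  have := leq_trans (subset_leq_card sub) (leq_card_setU _ _).1.
  by have := TM; rewrite /M /q; nia.
have [F [F0 rob] wfF] := robust_paths q_gt0 T0 degT.
pose m := a.*2.-1.
have [||||p [pF pj pd]] := @alternating_chain _ _ supp en q F b.+1 m rob F0.
- move=> p _; rewrite cardsE (leq_trans (card_size _)) // /vseq /=.
  by rewrite size_rcons size_tuple prednK.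
- by rewrite /m /q; nia.
- move=> p /wfF/and3P[_ /= /andP[+ _] _]; apply: contraNneq; rewrite /en => ->.
  by rewrite mem_rcons mem_head.
- by move=> [] [[x I] y]; rewrite inE /vseq /en /= inE ?mem_rcons ?mem_head ?eqxx ?orbT.
pose Q := \bigcup_(i < m.+1) supp (p i).
pose Y k := (p k).2.
have suppQ k v : k <= m -> v \in supp (p k) -> v \in Q.
  by move=> km vp; apply/bigcupP; exists (Ordinal (km : k < m.+1)).
have memY k : Y k \in supp (p k) by rewrite inE inE mem_rcons mem_head orbT.
have pT k v : k <= m -> v \in supp (p k) -> v \in T.
  by move=> /pF/wfF/and3P[_ _ /allP pT]; rewrite inE => /pT.
have QM : 2 * #|Q| <= M.
  rewrite leq_mul //; apply: leq_trans (card_bigcup_le _ _) _.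
  apply: (@leq_trans (\sum_(i < m.+1) b.+1)).
    apply: leq_sum => i _; rewrite cardsE (leq_trans (card_size _)) // /vseq /=.
    by rewrite size_rcons size_tuple prednK.
  by rewrite sum_nat_const card_ord /m /q; nia.
(* As [m >= 3], paths 0 and [m] are not consecutive, hence disjoint. *)
have Y0m : Y 0 != Y m.
  apply/eqP => e; have [||] := pd 0 m (Y 0) _ (memY 0); rewrite ?e ?memY //.
    by rewrite /m; lia.
  by rewrite /m; lia.
have endQ k : k <= m -> Y k \in T :&: Q.
  by move=> km; rewrite inE (pT k) ?(suppQ k) ?memY.
have [A [B [w [eA eB uAB avoid]]]] :=
  meeting_paths TM Tmin QM (endQ 0 (leq0n m)) (endQ m (leqnn m)) Y0m.
apply: (contains_Cab_of_chain _ _ pj pd eA eB uAB).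
- by rewrite /m; lia.
- by move=> k /pF/wfF/and3P[].
by move=> v k /avoid Qv km; apply: contra Qv; apply: suppQ.
Qed.

End Main.

Theorem theorem2p2 :
  exists C : nat, forall a b : nat, 2 <= a -> 1 <= b ->
    forall (V : finType) (E : rel V),
      irreflexive E -> 0 < #|V| ->
      min_outdeg_ge E (C * a * b ^ 7) ->
      dgirth_ge E (4 * b ^ 2) ->
      contains_subdivision (@Cab_rel a b) E.
Proof.
exists 21 => a b a_gt1 b_gt0 V E _ V_gt0 degE _.
apply: subdivision_Cab => // v; apply: leq_trans (degE v).
by rewrite leq_mul // leq_pexp2l.
Qed.
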